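(* Let $\circ_1,\circ_2\in\{\cup,\cap,\oplus\}$. For all integers $m,n,p\geq 3$, the state complexity of the ternary operation $(L_1,L_2,L_3)\mapsto (L_1\circ_1 L_2)\circ_2 L_3$ satisfies $\mathrm{sc}_{(\star\circ_1\star)\circ_2\star}(m,n,p)=mnp$, and this value is reached by languages over a two-letter alphabet: there exist regular languages $L_1,L_2,L_3$ over a two-letter alphabet, with $\mathrm{sc}(L_1)=m$, $\mathrm{sc}(L_2)=n$, $\mathrm{sc}(L_3)=p$ and $\mathrm{sc}((L_1\circ_1 L_2)\circ_2 L_3)=mnp$.
   Context: For a regular language $L$ over a finite alphabet $\Sigma$, $\mathrm{sc}(L)$ denotes the number of states of its minimal complete deterministic finite automaton over $\Sigma$. For a ternary operation $\otimes$ on languages, its state complexity is the function $\mathrm{sc}_\otimes(m,n,p)=\max \mathrm{sc}(\otimes(L_1,L_2,L_3))$, the maximum being over all finite alphabets $\Sigma$ and all regular languages $L_1,L_2,L_3$ over the same alphabet $\Sigma$ with $\mathrm{sc}(L_1)=m$, $\mathrm{sc}(L_2)=n$, $\mathrm{sc}(L_3)=p$. The symbol $\oplus$ denotes symmetric difference. *)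

(* Defs.v *)
From mathcomp Require Import all_boot all_order.
From mathcomp Require Import boolp classical_sets.

Set Implicit Arguments.
Unset Strict Implicit.
Unset Printing Implicit Defensive.

Local Open Scope classical_set_scope.

Definition language (Sigma : finType) := set (seq Sigma).

(* The transition function is total: automata are complete. *)
Record dfa (Sigma : finType) := Dfa {
  dfa_state :> finType;
  dfa_start : dfa_state;
  dfa_final : {set dfa_state};
  dfa_trans : dfa_state -> Sigma -> dfa_state }.

Definition dfa_lang (Sigma : finType) (A : dfa Sigma) : language Sigma :=
  [set w | foldl (@dfa_trans Sigma A) (dfa_start A) w \in dfa_final A].

Definition regular (Sigma : finType) (L : language Sigma) : Prop :=
  exists A : dfa Sigma, dfa_lang A = L.

Definition minimal_dfa (Sigma : finType) (A : dfa Sigma) : Prop :=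
  forall B : dfa Sigma, dfa_lang B = dfa_lang A -> #|A| <= #|B|.

(* Number of states of a minimal automaton of L; by [sc_minimal] it does not
   depend on the choice of that automaton. The value is 0 when L is not
   regular, whereas it is positive for regular L. *)
Definition sc (Sigma : finType) (L : language Sigma) : nat :=
  xget 0 [set k | exists A : dfa Sigma,
    [/\ dfa_lang A = L, minimal_dfa A & #|A| = k]].

Lemma sc_minimal (Sigma : finType) (A : dfa Sigma) :
  minimal_dfa A -> sc (dfa_lang A) = #|A|.
Proof.
move=> minA; apply: xget_unique; first by exists A.
move=> k [B [eqBA minB <-]]; apply/eqP.
by rewrite eqn_leq minB ?eqBA // minA.
Qed.

Lemma regular_minimal (Sigma : finType) (L : language Sigma) :
  regular L -> exists2 A : dfa Sigma, dfa_lang A = L & minimal_dfa A.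
Proof.
move=> [A0 eqA0].
have exk : exists k, `[< exists2 A : dfa Sigma, dfa_lang A = L & #|A| = k >].
  by exists #|A0|; apply/asboolP; exists A0.
case: (ex_minnP exk) => k /asboolP[A eqA cardA] min_k.
exists A => // B eqB; rewrite cardA; apply: min_k.
by apply/asboolP; exists B; rewrite // eqB.
Qed.

Definition ternary_op :=
  forall Sigma : finType,
    language Sigma -> language Sigma -> language Sigma -> language Sigma.

Definition preserves_regular (op : ternary_op) : Prop :=
  forall (Sigma : finType) (L1 L2 L3 : language Sigma),
    regular L1 -> regular L2 -> regular L3 -> regular (op Sigma L1 L2 L3).

Definition sc_values (op : ternary_op) (m n p : nat) : set nat :=
  [set k | exists (Sigma : finType) (L1 L2 L3 : language Sigma),
    [/\ regular L1, regular L2 & regular L3] /\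
    [/\ sc L1 = m, sc L2 = n, sc L3 = p & sc (op Sigma L1 L2 L3) = k]].

(* k is the maximum of [sc_values op m n p]. Preservation of regularity is
   required so that no default value of [sc] enters the maximum. *)
Definition is_state_complexity (op : ternary_op) (m n p k : nat) : Prop :=
  [/\ preserves_regular op,
      sc_values op m n p k & ubound (sc_values op m n p) k].

Inductive boolean_op := Union | Intersection | SymmetricDifference.

Definition apply_op (o : boolean_op) (Sigma : finType)
    (L1 L2 : language Sigma) : language Sigma :=
  match o with
  | Union => L1 `|` L2
  | Intersection => L1 `&` L2
  | SymmetricDifference => L1 `+` L2
  end.

(* Main.v *)
(** Over the letters [true] and [false], the first automaton counts the
    occurrences of [true] modulo [m] and the second one counts those of
    [false] modulo [n]. On the third one, with states the integers modulo [p],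
    [true] is the cycle [k -> k + 1] and [false] the transposition of [0] and
    [1]. A commutator of words does not move the first two automata, but it can
    take any state [k] of the third one to [k - 1]; hence the product automaton
    is strongly connected, for any [m], [n], [p]. Take [0] as the only final
    state of each automaton. A word that takes one of two distinct states of the
    product to a well-chosen triple distinguishes them; as each coordinate has
    at least three values, a suitable triple keeps an unwanted coordinate
    nonzero for both states at once. *)

Require Import Defs.
From mathcomp Require Import all_boot all_order.
From mathcomp Require Import boolp classical_sets.
From mathcomp Require Import all_algebra perm.

Set Implicit Arguments.
Unset Strict Implicit.
Unset Printing Implicit Defensive.

Import GRing.Theory.

(** * Runs of automata and a criterion for minimality *)

Definition run (Sigma : finType) (A : dfa Sigma) : A -> seq Sigma -> A :=
  foldl (@dfa_trans Sigma A).

Lemma run_cat (Sigma : finType) (A : dfa Sigma) (s : A) u v :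
  run s (u ++ v) = run (run s u) v.
Proof. exact: foldl_cat. Qed.

Lemma run_cons (Sigma : finType) (A : dfa Sigma) (s : A) x w :
  run s (x :: w) = run (dfa_trans s x) w.
Proof. by []. Qed.

Lemma dfa_langE (Sigma : finType) (A : dfa Sigma) w :
  dfa_lang A w = (run (dfa_start A) w \in dfa_final A).
Proof. by []. Qed.

Lemma regular_dfa (Sigma : finType) (A : dfa Sigma) : regular (dfa_lang A).
Proof. by exists A. Qed.

Lemma sc_le (Sigma : finType) (A : dfa Sigma) : sc (dfa_lang A) <= #|A|.
Proof.
have [B eqBA minB] := regular_minimal (regular_dfa A).
by rewrite -eqBA sc_minimal // minB.
Qed.

(** Send each state [s] of [A] to the state of [B] reached by a word that leads to [s] in [A]. No
    word distinguishes two states with the same image, so this map is injective. *)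
Lemma minimal_dfaI (Sigma : finType) (A : dfa Sigma) :
    (forall s : A, exists w, run (dfa_start A) w = s) ->
    (forall s t : A, s != t ->
      exists w, (run s w \in dfa_final A) != (run t w \in dfa_final A)) ->
  minimal_dfa A.
Proof.
move=> reach dist B eqBA; have [wd wdP] := choice reach.
apply: (@leq_card _ _ (fun s => run (dfa_start B) (wd s))) => s t eq_st.
apply/eqP/negP => /negP /dist[w] /negP; apply; apply/eqP.
have accE u : (run (dfa_start A) (wd u ++ w) \in dfa_final A) =
              (run (dfa_start B) (wd u ++ w) \in dfa_final B).
  by apply/is_true_inj; rewrite -!dfa_langE eqBA.
by rewrite -[s]wdP -[t]wdP -!run_cat !accE !run_cat eq_st.
Qed.

(** * Boolean operations and product automata *)

Definition bool_of_op (o : boolean_op) : bool -> bool -> bool :=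
  match o with
  | Union => orb
  | Intersection => andb
  | SymmetricDifference => addb
  end.

Lemma apply_opE o (Sigma : finType) (L1 L2 : language Sigma) w (b1 b2 : bool) :
  L1 w = b1 -> L2 w = b2 -> apply_op o L1 L2 w = bool_of_op o b1 b2.
Proof.
move=> L1w L2w; apply/propext.
case: o => /=; rewrite /setY /setD /setU /setI /= L1w L2w.
- by split=> [/orP|/orP].
- by split=> [/andP|/andP].
- by case: b1 {L1w}; case: b2 {L2w}; split=> //=; intuition.
Qed.

Definition prod_dfa (o : boolean_op) (Sigma : finType) (A B : dfa Sigma) :=
  @Dfa Sigma (A * B)%type (dfa_start A, dfa_start B)
    [set s | bool_of_op o (s.1 \in dfa_final A) (s.2 \in dfa_final B)]
    (fun s x => (dfa_trans s.1 x, dfa_trans s.2 x)).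

Lemma run_prod o (Sigma : finType) (A B : dfa Sigma) (s : A) (t : B) w :
  run ((s, t) : prod_dfa o A B) w = (run s w, run t w).
Proof. by elim: w s t => // x w IHw s t; rewrite !run_cons IHw. Qed.

Lemma prod_accept o (Sigma : finType) (A B : dfa Sigma) (s : prod_dfa o A B) :
  (s \in dfa_final (prod_dfa o A B)) =
  bool_of_op o (s.1 \in dfa_final A) (s.2 \in dfa_final B).
Proof. by rewrite inE. Qed.

Lemma prod_dfa_lang o (Sigma : finType) (A B : dfa Sigma) :
  dfa_lang (prod_dfa o A B) = apply_op o (dfa_lang A) (dfa_lang B).
Proof.
apply/funext => w; rewrite (apply_opE o (dfa_langE A w) (dfa_langE B w)).
by rewrite dfa_langE run_prod prod_accept.
Qed.

(** * The witness automata *)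

Definition cycle_dfa (n : nat) (x : bool) : dfa bool :=
  @Dfa bool 'I_n.+3 0%R [set 0%R] (fun k y => if y == x then (k + 1)%R else k).

Definition sym_dfa (n : nat) : dfa bool :=
  @Dfa bool 'I_n.+3 0%R [set 0%R]
    (fun k y => if y then (k + 1)%R else tperm 0%R 1%R k).

Lemma run_cycle n x (k : cycle_dfa n x) w :
  run k w = (k + (count_mem x w)%:R)%R :> 'I_n.+3.
Proof.
elim: w k => [|y w IHw] k; first by rewrite addr0.
rewrite run_cons IHw /=; case: eqP => _ //=.
by rewrite natrD addrA.
Qed.

Lemma run_sym_true n (k : sym_dfa n) e :
  run k (nseq e true) = (k + e%:R)%R :> 'I_n.+3.
Proof.
elim: e k => [|e IHe] k; first by rewrite addr0.
by rewrite run_cons IHe -natr1 addrA addrAC.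
Qed.

Lemma run_sym_false n (k : sym_dfa n) e :
  run k (nseq e false) = (if odd e then tperm 0%R 1%R k else k) :> 'I_n.+3.
Proof.
elim: e k => [|e IHe] k //.
by rewrite run_cons IHe /=; case: (odd e) => //=; rewrite tpermK.
Qed.

(** Every letter permutes the states. Hence distinct third coordinates never reach the final state
    together. *)
Lemma run_sym_inj n w : injective (fun k : sym_dfa n => run k w).
Proof.
elim: w => [|y w IHw] k l //= /IHw /=.
by case: y => [/addIr|/perm_inj].
Qed.

Lemma count_mem_nseq n (x y : bool) :
  count_mem x (nseq n y) = (if y == x then n else 0).
Proof. by rewrite count_nseq /=; case: (y == x); rewrite ?mul1n ?mul0n. Qed.

(** * Strong connectivity of the product *)

Lemma natr_ord_char n q : ((n.+3 * q)%:R = 0 :> 'I_n.+3)%R.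
Proof. by rewrite natrM [X in (X * _)%R](@pchar_Zp n.+3) ?mul0r. Qed.

(* The word is a conjugate of the commutator of [true] and [false], inverses
   being replaced by positive powers. *)
Lemma sym_step m n p (k : 'I_p.+3) : exists w,
  [/\ (count_mem true w)%:R = 0 :> 'I_m.+3,
      (count_mem false w)%:R = 0 :> 'I_n.+3
    & run (k : sym_dfa p) w = k - 1 :> 'I_p.+3]%R.
Proof.
(* Modulo both [m.+3] and [p.+3], [q] is -1: [q] letters [true] undo one. *)
have [q qE] : exists q, q.+1 = (m.+3 * p.+3)%N by eexists.
pose e := val (- k)%R.
have q0 : (q.+1%:R = 0 :> 'I_p.+3)%R by rewrite qE mulnC natr_ord_char.
have eE : (e%:R = - k :> 'I_p.+3)%R by rewrite natr_Zp.
have le_eq : e <= q.+1.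
  by rewrite qE ltnW // (leq_trans (ltn_ord _)) // leq_pmull.
(* After the successive blocks, the state [k] has become 1, 0, -1, -1, [k - 1]. The second block of
   [false] has odd length, so it acts as one transposition, and it fixes -1 because -1 differs from
   0 and 1 modulo [p.+3]. *)
exists (nseq e.+1 true ++ nseq 1 false ++ nseq q true ++
        nseq (n.+2 * 2).+1 false ++ nseq (q.+1 - e) true); split.
- rewrite !count_cat !count_mem_nseq /=.
  rewrite (_ : _ + _ = m.+3 * (p.+3 * 2)) ?natr_ord_char //.
  by rewrite mulnA -qE !add0n addnCA addSn subnKC // addnS -addSn muln2 addnn.
- rewrite !count_cat !count_mem_nseq.
  by rewrite !add0n addn0 (_ : _ + _ = n.+3 * 2) ?natr_ord_char.
have q1 : (q%:R = -1 :> 'I_p.+3)%R by apply/eqP; rewrite -addr_eq0 natr1 q0.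
rewrite !run_cat !run_sym_true !run_sym_false oddS oddM andbF /=.
rewrite -natr1 eE addrA subrr add0r tpermR add0r q1 natrB // q0 eE tpermD.
- by rewrite add0r opprK addrC.
- by rewrite eq_sym oppr_eq0 oner_eq0.
- by rewrite -addr_eq0.
Qed.

Lemma sym_connected m n p (k l : 'I_p.+3) : exists w,
  [/\ (count_mem true w)%:R = 0 :> 'I_m.+3,
      (count_mem false w)%:R = 0 :> 'I_n.+3
    & run (k : sym_dfa p) w = l :> 'I_p.+3]%R.
Proof.
rewrite -[l](subKr k) -[(k - l)%R]natr_Zp.
elim: (val (k - l)%R) => [|t [w [w1 w2 wk]]]; first by exists [::]; rewrite subr0.
have [v [v1 v2 vk]] := sym_step m n (k - t%:R)%R.
exists (w ++ v); rewrite !count_cat !natrD w1 w2 v1 v2 !addr0; split=> //.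
by rewrite run_cat wk vk -natr1 opprD addrA.
Qed.

(** Suitable letter counts settle the two cycles first; a word that fixes both cycles then corrects
    the third state. *)
Lemma product_connected m n p (i i' : 'I_m.+3) (j j' : 'I_n.+3) (k k' : 'I_p.+3) :
  exists w, [/\ (count_mem true w)%:R = i' - i, (count_mem false w)%:R = j' - j
    & run (k : sym_dfa p) w = k' :> 'I_p.+3]%R.
Proof.
have natP n' (x : 'I_n'.+3) : exists a : nat, (a%:R = x)%R.
  by exists x; rewrite natr_Zp.
have [[a aE] [b bE]] := (natP _ (i' - i)%R, natP _ (j' - j)%R).
pose u := nseq a true ++ nseq b false.
have [v [v1 v2 vk]] := sym_connected m n (run (k : sym_dfa p) u) k'.
exists (u ++ v); rewrite !count_cat !count_mem_nseq /= addn0 add0n !natrD.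
by rewrite v1 v2 !addr0 aE bE run_cat.
Qed.

(** * Separation of distinct states *)

Lemma ord_avoid n (x y : 'I_n.+3) : exists z, (z != x) && (z != y).
Proof.
have /subsetPn[z _] : ~~ ([set: 'I_n.+3] \subset [set x; y]).
  apply/negP => /subset_leq_card; rewrite cardsT card_ord cards2.
  by case: (x != y).
by rewrite !inE negb_or => zP; exists z.
Qed.

Lemma nonzero_shift n (d : 'I_n.+3) : exists i : 'I_n.+3,
  (i == 0)%R = false /\ (i + d == 0)%R = false.
Proof.
have [i /andP[/negbTE i0 /negbTE id]] := ord_avoid 0%R (- d)%R.
by exists i; rewrite addr_eq0.
Qed.

(** Here [d] and [e] are the differences of two states in the two cycles. For intersection, (0, 0)
    is the only accepting pair. Otherwise a differing coordinate is put at 0 while the other is kept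
    nonzero in both states. *)
Lemma separate_pair o m n (d : 'I_m.+3) (e : 'I_n.+3) : ~~ ((d == 0) && (e == 0))%R ->
  exists (i : 'I_m.+3) (j : 'I_n.+3),
    (bool_of_op o (i == 0) (j == 0) != bool_of_op o (i + d == 0) (j + e == 0))%R.
Proof.
move=> de0; have [i0 [iF idF]] := nonzero_shift d.
have [j0 [jF jeF]] := nonzero_shift e.
case: o => /=; last first.
- have [d0|dN0] := eqVneq d 0%R.
    exists i0, 0%R; rewrite iF idF eqxx add0r; move: de0.
    by rewrite d0 eqxx /= => /negbTE ->.
  by exists 0%R, j0; rewrite jF jeF eqxx add0r (negbTE dN0).
- by exists 0%R, 0%R; rewrite !eqxx !add0r (negbTE de0).
- have [d0|dN0] := eqVneq d 0%R.
    exists i0, 0%R; rewrite iF idF eqxx add0r; move: de0.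
    by rewrite d0 eqxx /= => /negbTE ->.
  by exists 0%R, j0; rewrite jF jeF eqxx add0r (negbTE dN0).
Qed.

Lemma separate_third o1 o2 m n (d : 'I_m.+3) (e : 'I_n.+3) :
  exists (i : 'I_m.+3) (j : 'I_n.+3),
    (bool_of_op o2 (bool_of_op o1 (i == 0) (j == 0)) true !=
     bool_of_op o2 (bool_of_op o1 (i + d == 0) (j + e == 0)) false)%R.
Proof.
have [i0 [iF idF]] := nonzero_shift d.
have [j0 [jF jeF]] := nonzero_shift e.
case: o2 => /=.
- by exists i0, j0; rewrite iF idF jF jeF; case: o1.
(* Under intersection the first pair has to accept; for symmetric difference exactly one of its
   coordinates must be 0. *)
- by exists 0%R, (if o1 is SymmetricDifference then j0 else 0%R);
    rewrite andbF eqxx; case: o1; rewrite /= ?jF ?eqxx.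
- by exists i0, j0; rewrite iF idF jF jeF; case: o1.
Qed.

Lemma separate_fixed_third o1 o2 m n p (d : 'I_m.+3) (e : 'I_n.+3) :
  ~~ ((d == 0) && (e == 0))%R ->
  exists (i : 'I_m.+3) (j : 'I_n.+3) (k : 'I_p.+3),
    (bool_of_op o2 (bool_of_op o1 (i == 0) (j == 0)) (k == 0) !=
     bool_of_op o2 (bool_of_op o1 (i + d == 0) (j + e == 0)) (k == 0))%R.
Proof.
move=> /(separate_pair o1)[i [j ijP]].
(* The third coordinate is chosen to contribute the neutral element of [o2]. *)
exists i, j, (if o2 is Intersection then 0%R else 1%R).
by case: o2; rewrite /= ?eqxx ?oner_eq0 ?orbF ?andbT ?addbF.
Qed.

(** * Minimality of the automata *)

Definition product_dfa (o1 o2 : boolean_op) (m n p : nat) : dfa bool :=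
  prod_dfa o2 (prod_dfa o1 (cycle_dfa m true) (cycle_dfa n false)) (sym_dfa p).

Lemma product_accept o1 o2 m n p (i : 'I_m.+3) (j : 'I_n.+3) (k : 'I_p.+3) :
  (((i, j, k) : product_dfa o1 o2 m n p) \in dfa_final (product_dfa o1 o2 m n p)) =
  (bool_of_op o2 (bool_of_op o1 (i == 0) (j == 0)) (k == 0))%R.
Proof.
rewrite /product_dfa !prod_accept /=.
by congr (bool_of_op _ (bool_of_op _ _ _) _); rewrite finset.in_set1.
Qed.

Lemma product_minimal o1 o2 m n p : minimal_dfa (product_dfa o1 o2 m n p).
Proof.
apply: minimal_dfaI => [[[i j] k]|[[i j] k] [[i' j'] k'] neq_st].
  have [w [w1 w2 wk]] := product_connected 0%R i 0%R j 0%R k.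
  by exists w; rewrite !run_prod !run_cycle w1 w2 wk !subr0 !add0r.
(* A word translates both states equally in each cycle, so [i' - i] and [j' - j] persist; only the
   third coordinate of the second state is left uncontrolled. *)
have move_to x y z : exists w, [/\ run k w = z :> sym_dfa p,
    (run ((i, j, k) : product_dfa o1 o2 m n p) w \in dfa_final (product_dfa o1 o2 m n p)) =
      bool_of_op o2 (bool_of_op o1 (x == 0) (y == 0)) (z == 0) &
    (run ((i', j', k') : product_dfa o1 o2 m n p) w \in dfa_final (product_dfa o1 o2 m n p)) =
      bool_of_op o2 (bool_of_op o1 (x + (i' - i) == 0) (y + (j' - j) == 0))
        (run (k' : sym_dfa p) w == 0 :> 'I_p.+3)]%R.
  have [w [w1 w2 wk]] := product_connected i x j y k z.
  exists w; rewrite !run_prod !run_cycle w1 w2 wk product_accept product_accept.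
  by rewrite !(addrCA _ x) !(addrCA _ y) !subrr !addr0.
have [eqk|neqk] := eqVneq k k'.
  have [|x [y [z xyzP]]] := @separate_fixed_third o1 o2 m n p (i' - i)%R (j' - j)%R.
    apply: contra neq_st; rewrite !subr_eq0 eqk => /andP[/eqP-> /eqP->].
    exact: eqxx.
  have [w [wk acc acc']] := move_to x y z; exists w.
  by apply: contra xyzP => /eqP eq_acc; rewrite -acc eq_acc acc' -eqk wk.
have [x [y xyP]] := separate_third o1 o2 (i' - i)%R (j' - j)%R.
have [w [wk acc acc']] := move_to x y 0%R; exists w.
apply: contra xyP => /eqP eq_acc.
have k'wN0 : (run (k' : sym_dfa p) w == 0 :> 'I_p.+3)%R = false.
  by apply: contraNF neqk => /eqP k'w0; apply/eqP/(@run_sym_inj p w); rewrite wk k'w0.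
by move: acc; rewrite eqxx => <-; rewrite eq_acc acc' k'wN0.
Qed.

Lemma cycle_minimal n x : minimal_dfa (cycle_dfa n x).
Proof.
apply: minimal_dfaI => [k|k l neq_kl].
  by exists (nseq k x); rewrite run_cycle count_mem_nseq eqxx natr_Zp add0r.
(* This many steps bring [k], and no other state, to 0. *)
exists (nseq (val (- k)%R) x).
rewrite !run_cycle count_mem_nseq eqxx natr_Zp !inE subrr eqxx subr_eq0 eq_sym eqb_id eq_sym.
by apply: contra neq_kl => /eqP <-.
Qed.

Lemma sym_minimal n : minimal_dfa (sym_dfa n).
Proof.
apply: minimal_dfaI => [k|k l neq_kl].
  by exists (nseq k true); rewrite run_sym_true natr_Zp add0r.
exists (nseq (val (- k)%R) true).
rewrite !run_sym_true natr_Zp !inE subrr eqxx subr_eq0 eq_sym eqb_id eq_sym.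
by apply: contra neq_kl => /eqP <-.
Qed.

(** * State complexity of the ternary operations *)

Theorem theorem1 (o1 o2 : boolean_op) (m n p : nat)
    (hm : 3 <= m) (hn : 3 <= n) (hp : 3 <= p) :
  is_state_complexity
    (fun (Sigma : finType) (L1 L2 L3 : language Sigma) =>
       apply_op o2 (apply_op o1 L1 L2) L3)
    m n p (m * n * p) /\
  (exists (Sigma : finType) (L1 L2 L3 : language Sigma),
     #|Sigma| = 2 /\
     [/\ regular L1, regular L2 & regular L3] /\
     [/\ sc L1 = m, sc L2 = n, sc L3 = p &
         sc (apply_op o2 (apply_op o1 L1 L2) L3) = m * n * p]).
Proof.
case: m n p hm hn hp => [|[|[|m]]] // [|[|[|n]]] // [|[|[|p]]] // _ _ _.
pose A1 := cycle_dfa m true; pose A2 := cycle_dfa n false; pose A3 := sym_dfa p.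
have regA : [/\ regular (dfa_lang A1), regular (dfa_lang A2) & regular (dfa_lang A3)].
  by split; apply: regular_dfa.
have scA : [/\ sc (dfa_lang A1) = m.+3, sc (dfa_lang A2) = n.+3,
    sc (dfa_lang A3) = p.+3 &
    sc (apply_op o2 (apply_op o1 (dfa_lang A1) (dfa_lang A2)) (dfa_lang A3)) =
      m.+3 * n.+3 * p.+3].
  split; try by rewrite sc_minimal ?card_ord //;
    apply: cycle_minimal || apply: sym_minimal.
  rewrite -(prod_dfa_lang o1 A1 A2) -(prod_dfa_lang o2 _ A3).
  by rewrite (sc_minimal (@product_minimal o1 o2 m n p)) !card_prod !card_ord.
split; last by exists bool, (dfa_lang A1), (dfa_lang A2), (dfa_lang A3); rewrite card_bool.
split.
- move=> Sigma L1 L2 L3 [B1 <-] [B2 <-] [B3 <-].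
  by exists (prod_dfa o2 (prod_dfa o1 B1 B2) B3); rewrite !prod_dfa_lang.
- by exists bool, (dfa_lang A1), (dfa_lang A2), (dfa_lang A3).
(* Upper bound: the product of three minimal automata recognizes the combined language. *)
move=> _ [Sigma [L1 [L2 [L3 [[/regular_minimal[B1 <- min1] /regular_minimal[B2 <- min2]
  /regular_minimal[B3 <- min3]] [+ + + <-]]]]]].
rewrite !sc_minimal // => <- <- <-.
by have := sc_le (prod_dfa o2 (prod_dfa o1 B1 B2) B3); rewrite !prod_dfa_lang !card_prod.
Qed.
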